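(* There is a function $c:(0,\infty)\to(0,\infty)$ such that the following holds. Let $n\ge 1$ be an integer and let $\Omega$ be a bounded open domain in $\mathbb{R}^{n+1}$ with boundary $\partial\Omega$. Then for each real $m\in(0,n]$, $$\mathrm{HC}_m(\Omega)\le c(m)\,\mathrm{HC}_m(\partial\Omega).$$ The constant $c(m)$ depends only on $m$, not on the dimension $n+1$ of the ambient space.
   Context: For a subset $A$ of a metric space and a real $m\ge 0$, the $m$-dimensional Hausdorff content $\mathrm{HC}_m(A)$ is the infimum of $\sum_i r_i^m$ over all coverings of $A$ by collections of metric balls $B_i$, where $r_i$ is the radius of $B_i$. Here the metric on $\mathbb{R}^{n+1}$ is the Euclidean one. *)

(* Defs.v *)
From HB Require Import structures.
From mathcomp Require Import all_boot all_order all_algebra.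
From mathcomp Require Import all_classical all_reals all_analysis.
Set Implicit Arguments. Unset Strict Implicit. Unset Printing Implicit Defensive.
Import Order.TTheory GRing.Theory Num.Theory.
Import numFieldNormedType.Exports.
Local Open Scope classical_set_scope.
Local Open Scope ring_scope.

(* Points of R^k are row vectors 'rV[R]_k (with their canonical product topology,
   which coincides with the Euclidean topology). *)

Definition edist (R : realType) (k : nat) (x y : 'rV[R]_k) : R :=
  Num.sqrt (\sum_(i < k) (x ord0 i - y ord0 i) ^+ 2).

Definition eball (R : realType) (k : nat) (x : 'rV[R]_k) (r : R) : set 'rV[R]_k :=
  [set y | edist x y < r].

Definition ebounded (R : realType) (k : nat) (A : set 'rV[R]_k) : Prop :=
  exists (x : 'rV[R]_k) (M : R), A `<=` eball x M.

Definition tboundary (R : realType) (k : nat) (A : set 'rV[R]_k) : set 'rV[R]_k :=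
  closure A `\` interior A.

Definition HC (R : realType) (k : nat) (m : R) (A : set 'rV[R]_k) : \bar R :=
  ereal_inf [set (\sum_(0 <= i <oo) ((powR (r i) m)%:E))%E
            | r in [set r : nat -> R |
                exists x : nat -> 'rV[R]_k,
                  (forall i, 0 < r i) /\ A `<=` \bigcup_i eball (x i) (r i)]].

(* Main.v *)
(** Cover the compact boundary by finitely many balls B(x_i, r_i). For every p in
    Omega there is a radius rho such that the sum of r_i^m over the centers x_i in
    B(p, rho) is at least a constant times rho^m. Otherwise, let k be the ceiling
    of m and look at the grids p + rho_j [1, 2]^(k+1), with rho_j = 2^j rho_0, in the
    slice through p spanned by the first k+1 coordinates. Join a point of one
    grid to a point of the next by changing the coordinates one after the other:
    only few of these paths meet a ball, and a path that meets none stays on one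
    side of the boundary. Hence if Omega contains half of one grid, it contains
    half of the next, although it contains the small grids and misses the large
    ones. As the slice has dimension k+1 <= n+1, the constant depends on m only. A
    greedy selection of points p then covers Omega by the balls B(p, 3 rho(p)),
    with disjoint sets of centers charged. *)

Require Import Defs.
From HB Require Import structures.
From mathcomp Require Import all_boot all_order all_algebra.
From mathcomp Require Import all_classical all_reals all_analysis.
From mathcomp Require Import ring lra zify.
Import Order.TTheory GRing.Theory Num.Theory.
Import numFieldNormedType.Exports.
(* MathComp-Analysis has another [edist]. *)
Import Defs.
Local Open Scope classical_set_scope.
Local Open Scope ring_scope.

(** * The Euclidean distance *)

Lemma cauchy_schwarz (R : realFieldType) (I : finType) (a b : I -> R) :
  (\sum_i a i * b i) ^+ 2 <= (\sum_i a i ^+ 2) * (\sum_i b i ^+ 2).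
Proof.
set A := \sum_i a i ^+ 2; set B := \sum_i b i ^+ 2; set C := \sum_i a i * b i.
have A0 : 0 <= A by apply: sumr_ge0 => i _; exact: sqr_ge0.
have sqE s t : \sum_i (s * b i - t * a i) ^+ 2 =
    s ^+ 2 * B - 2 * s * t * C + t ^+ 2 * A.
  rewrite /A /B /C !mulr_sumr -sumrB -big_split /=.
  by apply: eq_bigr => i _; ring.
(* The vector [A b - C a] is [A] times the part of [b] orthogonal to [a]; its squared norm settles
   the case [A > 0]. *)
have E : \sum_i (A * b i - C * a i) ^+ 2 = A * (A * B - C ^+ 2).
  by rewrite sqE; ring.
have : 0 <= A * (A * B - C ^+ 2).
  by rewrite -E; apply: sumr_ge0 => i _; exact: sqr_ge0.
have [A1|] := ltP 0 A; first by rewrite pmulr_rge0// subr_ge0.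
move=> A1 _; have /eqP A2 : A == 0 by rewrite eq_le A1 A0.
rewrite A2 mul0r /C big1 ?expr0n// => i _.
have /eqP := A2; rewrite psumr_eq0 => [/allP|j _]; last exact: sqr_ge0.
by move=> /(_ i (mem_index_enum i)); rewrite /= sqrf_eq0 => /eqP ->; rewrite mul0r.
Qed.

Lemma edist_ge0 {R : realType} {k : nat} (x y : 'rV[R]_k) : 0 <= edist x y.
Proof. exact: sqrtr_ge0. Qed.

Lemma edistC {R : realType} {k : nat} (x y : 'rV[R]_k) : edist x y = edist y x.
Proof.
by congr Num.sqrt; apply: eq_bigr => i _; rewrite -sqrrN opprB.
Qed.

Lemma edist_coord {R : realType} {k : nat} (x y : 'rV[R]_k) (i : 'I_k) :
  `|x ord0 i - y ord0 i| <= edist x y.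
Proof.
rewrite -sqrtr_sqr ler_wsqrtr// (bigD1 i)//= lerDl.
by apply: sumr_ge0 => j _; exact: sqr_ge0.
Qed.

Lemma edist_triangle {R : realType} {k : nat} (y x z : 'rV[R]_k) :
  edist x z <= edist x y + edist y z.
Proof.
rewrite -(@ler_pXn2r _ 2)// ?nnegrE ?addr_ge0 ?edist_ge0//.
pose a i := x ord0 i - y ord0 i; pose b i := y ord0 i - z ord0 i.
have sq (u : 'I_k -> R) : 0 <= \sum_i u i ^+ 2.
  by apply: sumr_ge0 => i _; exact: sqr_ge0.
rewrite sqrrD /edist !sqr_sqrtr ?sq// -sqrtrM ?sq//.
have -> : \sum_i (x ord0 i - z ord0 i) ^+ 2 =
    \sum_i a i ^+ 2 + \sum_i b i ^+ 2 + 2 * \sum_i a i * b i.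
  rewrite mulr_sumr -!big_split /=.
  by apply: eq_bigr => i _; rewrite /a /b; ring.
rewrite [leRHS]addrAC lerD2l -[leRHS]mulr_natl ler_pM2l//.
rewrite (le_trans (ler_norm _))// -sqrtr_sqr ler_wsqrtr//.
exact: cauchy_schwarz.
Qed.

Lemma continuous_edist {R : realType} {k : nat} (x : 'rV[R]_k) :
  continuous (edist x).
Proof.
have cS : continuous (fun z : 'rV[R]_k => \sum_i (x ord0 i - z ord0 i) ^+ 2).
  refine (@continuous_big R 'I_k +%R 0 xpredT
    (@pseudometric_normed_Zmodule.add_continuous _ R) 'rV[R]_k
    (index_enum 'I_k) (fun i z => (x ord0 i - z ord0 i) ^+ 2) _) => i _ y.
  apply: (@continuous_comp _ _ _
    (fun z : 'rV[R]_k => x ord0 i - z ord0 i) (fun t : R => t ^+ 2)).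
    by apply: continuousB; [exact: cst_continuous|exact: coord_continuous].
  exact: exprn_continuous.
move=> y; apply: (continuous_comp (cS y)); exact: sqrt_continuous.
Qed.

Lemma open_eball {R : realType} {k : nat} (x : 'rV[R]_k) (r : R) :
  open (eball x r).
Proof.
have -> : eball x r = edist x @^-1` [set t | t < r] by [].
by apply: open_comp => [y _|]; [exact: continuous_edist|exact: open_lt].
Qed.

(** * Compactness of the boundary, and segments leaving an open set *)

Lemma closed_tboundary {R : realType} {k : nat} (A : set 'rV[R]_k) :
  closed (tboundary A).
Proof.
by apply: closedI; [exact: closed_closure|apply/open_closedC/open_interior].
Qed.

Lemma compact_tboundary {R : realType} {k : nat} (A : set 'rV[R]_k) :
  ebounded A -> compact (tboundary A).
Proof.
move=> [x [M AM]]; apply: bounded_closed_compact; last exact: closed_tboundary.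
have clA y : closure A y -> edist x y <= M.
  have cM : closed [set y | edist x y <= M].
    have -> : [set y | edist x y <= M] = edist x @^-1` [set t | t <= M] by [].
    by apply: closed_comp => [z _|]; [exact: continuous_edist|exact: closed_le].
  move=> Ay; apply: (cM y); apply: closure_subset Ay => z /AM.
  exact: ltW.
exists (`|x| + M); split => [|K xMK y [/clA yM _]]; first exact: num_real.
apply: (le_trans _ (ltW xMK)).
have M0 : 0 <= M by rewrite (le_trans _ yM)// edist_ge0.
rewrite -[`|y|]/(mx_norm y) mx_normrE; apply: bigmax_le => [|[i j] _ /=].
  by rewrite addr_ge0.
have := edist_coord x y j; rewrite (ord1 i) => xy.
have -> : y ord0 j = x ord0 j - (x ord0 j - y ord0 j) by ring.
rewrite (le_trans (ler_normB _ _))// lerD//; last exact: le_trans xy yM.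
rewrite -[`|x|]/(mx_norm x) mx_normrE.
exact: (le_bigmax _ (fun ij : 'I_1 * 'I_k => `|x ij.1 ij.2|) (ord0, j)).
Qed.

Lemma finite_subcover_tboundary {R : realType} {k : nat} (A : set 'rV[R]_k)
    (x : nat -> 'rV[R]_k) (r : nat -> R) :
  ebounded A -> tboundary A `<=` \bigcup_i eball (x i) (r i) ->
  exists n0 : nat, forall z, tboundary A z ->
    exists i : 'I_n0, edist (x i) z < r i.
Proof.
move=> /compact_tboundary; rewrite compact_cover => cA cov.
have [|D _ Dcov] := cA _ setT (fun i => eball (x i) (r i)) _ cov.
  by move=> i _; exact: open_eball.
exists (\max_(i <- finmap.enum_fset D) i).+1 => z /Dcov [i /= iD zi].
have lt : (i < (\max_(i <- finmap.enum_fset D) i).+1)%N.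
  by rewrite ltnS; apply: (@leq_bigmax_seq _ _ predT).
by exists (Ordinal lt).
Qed.

(** If the segment missed the boundary, [A] would be relatively open and closed in it, hence by
    connectedness contain all of it, [b] included. *)
Lemma segment_meets_boundary {R : realType} {k : nat} (A : set 'rV[R]_k)
    (a b : 'rV[R]_k) :
  open A -> A a -> ~ A b ->
  exists2 t : R, 0 <= t <= 1 & tboundary A (a + t *: (b - a)).
Proof.
move=> oA Aa Ab.
pose g (t : R) := a + t *: (b - a).
have cS : connected (g @` `[0, 1]).
  apply: connected_continuous_connected; first exact: segment_connected.
  apply: continuous_subspaceT => t; apply: cvgD; first exact: cvg_cst.
  by apply: cvgZr_tmp; exact: cvg_id.
apply: contrapT => noB.
have SA : g @` `[0, 1] `&` A = g @` `[0, 1].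
  apply: cS.
  - exists a; split => //; exists 0; last by rewrite /g scale0r addr0.
    by rewrite /= in_itv/= lexx ler01.
  - by exists A.
  - exists (closure A); first exact: closed_closure.
    apply/seteqP; split => z [Sz Az]; split => //; first exact: subset_closure.
    case: Sz Az => t t01 <- At; apply: contrapT => nA; apply: noB.
    exists t; first by move: t01; rewrite /= in_itv.
    by split => // /interior_subset.
apply: Ab; have : (g @` `[0, 1]) b.
  exists 1; last by rewrite /g scale1r addrC subrK.
  by rewrite /= in_itv/= lexx ler01.
by rewrite -SA => -[].
Qed.

(** * Counting indices and pairs of indices *)

Lemma card_le_sum_cover (T J : finType) (A : pred T) (Q : pred J)
    (S : J -> pred T) :
  (forall z, A z -> exists2 j, Q j & S j z) ->
  (#|A| <= \sum_(j | Q j) #|S j|)%N.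
Proof.
move=> AS; rewrite -sum1_card.
under [leqRHS]eq_bigr do rewrite -sum1_card big_mkcond.
rewrite exchange_big big_mkcond /=; apply: leq_sum => z _.
by case: ifPn => // /AS [j Qj Sj]; rewrite (bigD1 j)//= {1}/in_mem /= Sj.
Qed.

(** If [b] is the smallest and [c] the largest index counted, then [h (c - b) < 2 r], so there are
    at most [2 r / h + 1] of them, and [1 <= r / h]. *)
Lemma card_ord_near {R : realType} (M : nat) (s h r : R) : 0 < h -> h <= r ->
  #|[pred a : 'I_M | `|s + h * a%:R| < r]|%:R <= 3 * r / h.
Proof.
move=> h0 hr; set A := [pred a : 'I_M | _].
have r0 : 0 < r := lt_le_trans h0 hr.
case: (pickP A) => [a0 Aa0|A0]; last first.
  by rewrite eq_card0// divr_ge0 ?mulr_ge0// ltW.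
have [b Ab bmin] := @arg_minnP _ a0 A (fun a => a : nat) Aa0.
have [c Ac cmax] := @arg_maxnP _ a0 A (fun a => a : nat) Aa0.
have cardA : (#|A| <= (c - b).+1)%N.
  rewrite cardE -(size_map (fun a : 'I_M => a : nat)).
  rewrite -(size_iota b (c - b).+1); apply: uniq_leq_size.
    by rewrite map_inj_uniq ?enum_uniq//; exact: ord_inj.
  move=> _ /mapP [a + ->]; rewrite mem_enum => Aa.
  have ba := bmin a Aa; have ac : (a <= c)%N := cmax a Aa.
  by rewrite mem_iota ba addnS ltnS subnKC// (leq_trans ba).
have bc : (b <= c)%N := bmin c Ac.
apply: (@le_trans _ _ (c - b).+1%:R); first by rewrite ler_nat.
rewrite ler_pdivlMr// -natr1 natrB//.
move: Ab Ac; rewrite /A !inE !ltr_norml => /andP[b1 b2] /andP[c1 c2].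
by nra.
Qed.

Lemma card_family_natr {R : realType} (I : finType) (M : nat)
    (F : I -> pred 'I_M) :
  #|family F|%:R = \prod_i #|F i|%:R :> R.
Proof.
by rewrite card_family foldrE big_map big_enum /= natr_prod.
Qed.

Lemma card_ord_lt_neq (n N : nat) (l : 'I_n) : (N <= n)%N -> (l < N)%N ->
  #|[pred j : 'I_n | (j < N)%N && (j != l)]| = N.-1.
Proof.
move=> Nn lN.
have cN : #|[pred j : 'I_n | (j < N)%N]| = N.
  rewrite -sum1_card (big_ord_narrow Nn) /=.
  by rewrite sum1_card card_ord.
move: cN; rewrite (cardD1 l) inE /= lN => cN; rewrite -[in RHS]cN /=.
by apply: eq_card => j; rewrite !inE andbC.
Qed.

(** Each coordinate below [N] other than [l] is restricted in one of the two families, which gives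
    [N - 1] factors [kappa]; all other counts are bounded by [M]. *)
Lemma card_pair_family_le {R : realType} (n N M : nat) (l : 'I_n) (kappa : R)
    (F G : 'I_n -> pred 'I_M) :
  (N <= n)%N -> (l < N)%N -> 0 <= kappa ->
  (forall j : 'I_n, (l < j < N)%N -> #|F j|%:R <= kappa * M%:R) ->
  (forall j : 'I_n, (j < l)%N -> #|G j|%:R <= kappa * M%:R) ->
  #|predX (family F) (family G)|%:R <= kappa ^+ N.-1 * (M%:R ^+ n) ^+ 2.
Proof.
move=> Nn lN k0 HF HG.
have leM (H : pred 'I_M) : #|H|%:R <= M%:R :> R.
  by rewrite ler_nat -[leqRHS](card_ord M) max_card.
rewrite cardX natrM !card_family_natr -big_split /=.
apply: (@le_trans _ _ (\prod_(j < n)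
    ((if (j < N)%N && (j != l) then kappa else 1) * M%:R ^+ 2))).
  apply: ler_prod => j _; rewrite mulr_ge0//= expr2.
  case: ifPn => [/andP[jN jl]|_]; last first.
    by rewrite mul1r ler_pM.
  have [jl'|jl'|/ord_inj jl'] := ltngtP j l; last by rewrite jl' eqxx in jl.
  - rewrite mulrCA ler_pM ?leM//; exact: HG.
  - rewrite mulrA ler_pM ?leM//; apply: HF; rewrite jl' jN//.
rewrite big_split /= prodr_const card_ord -exprM mulnC exprM.
by rewrite -big_mkcond prodr_const card_ord_lt_neq.
Qed.

(** * Coordinatewise paths in a slice through a point *)

Definition slice_point {R : realType} {n : nat} (p : 'rV[R]_n) (N : nat)
    (f : 'I_n -> R) : 'rV[R]_n :=
  \row_l (p ord0 l + if (l < N)%N then f l else 0).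

(** At most [N] coordinates differ, so the bound involves the dimension of the slice and not [n]. *)
Lemma edist_slice_le {R : realType} {n : nat} (p z : 'rV[R]_n) (N : nat) (L : R) :
  (N <= n)%N -> 0 <= L ->
  (forall l : 'I_n, `|p ord0 l - z ord0 l| <= if (l < N)%N then L else 0) ->
  edist p z <= N%:R * L.
Proof.
move=> Nn L0 zL.
rewrite -(ger0_norm (_ : 0 <= N%:R * L)) ?mulr_ge0// -sqrtr_sqr ler_wsqrtr//.
apply: (@le_trans _ _ (\sum_(l < n) if (l < N)%N then L ^+ 2 else 0)).
  apply: ler_sum => l _; have := zL l; case: ifPn => _ zl.
    by rewrite -real_normK ?num_real// ler_sqr ?nnegrE.
  by move: zl; rewrite normr_le0 => /eqP ->; rewrite expr0n.
rewrite -big_mkcond (big_ord_narrow Nn) sumr_const card_ord exprMn -[leLHS]mulr_natl.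
case: N {Nn zL} => [|N]; first by rewrite !mul0r ?expr0n ?mul0r.
by rewrite ler_wpM2r ?sqr_ge0// expr2 ler_peMr// ler1n.
Qed.

(** The path replaces the coordinates of [f] by those of [g] one at a time, and some leg of it
    leaves [Omega]. On leg [l] the coordinates before [l] are already those of [g] and the later
    ones still those of [f]. *)
Lemma coordinate_path_meets_boundary {R : realType} {n : nat}
    (Omega : set 'rV[R]_n) (p : 'rV[R]_n) (N : nat) (f g : 'I_n -> R) (L : R) :
  open Omega -> (N <= n)%N -> 0 <= L ->
  (forall l, 0 <= f l <= L) -> (forall l, 0 <= g l <= L) ->
  Omega (slice_point p N f) -> ~ Omega (slice_point p N g) ->
  exists (l : 'I_n) (z : 'rV[R]_n),
    [/\ (l < N)%N, tboundary Omega z, edist p z <= N%:R * L,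
      forall j : 'I_n, (j < l)%N -> z ord0 j = p ord0 j + g j &
      forall j : 'I_n, (l < j < N)%N -> z ord0 j = p ord0 j + f j].
Proof.
move=> oO Nn L0 fL gL Of Og.
pose h s := slice_point p N (fun l => if (l < s)%N then g l else f l).
have h0 : h 0%N = slice_point p N f by [].
have hN : h N = slice_point p N g.
  by apply/rowP => l; rewrite !mxE; case: (l < N)%N.
have [s [sN Os nOs]] : exists s, [/\ (s < N)%N, Omega (h s) & ~ Omega (h s.+1)].
  apply: contrapT => noS.
  have Oh s : (s <= N)%N -> Omega (h s).
    elim: s => [|s IH] sN; first by rewrite h0.
    apply: contrapT => nOs; apply: noS; exists s; split => //.
    exact: IH (ltnW sN).
  by apply: Og; rewrite -hN; exact: Oh.
have [t /andP[t0 t1] zB] := segment_meets_boundary _ _ _ oO Os nOs.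
pose l := Ordinal (leq_trans sN Nn).
exists l, (h s + t *: (h s.+1 - h s)).
have zE (j : 'I_n) : (h s + t *: (h s.+1 - h s)) ord0 j = p ord0 j +
    if (j < N)%N then
      if (j < s)%N then g j else if j == l then f j + t * (g j - f j) else f j
    else 0.
  rewrite !mxE ltnS; case: ifPn => jN; last by ring.
  have -> : (j == l) = (j == s :> nat) by [].
  by case: (ltngtP j s) => js; ring.
split => //.
- apply: edist_slice_le => // j; rewrite zE opprD addrA subrr sub0r normrN.
  case: ifPn => jN; last by rewrite normr0.
  have /andP[f0 f1] := fL j; have /andP[g0 g1] := gL j.
  case: ifPn => _; first by rewrite ger0_norm.
  case: ifPn => _; last by rewrite ger0_norm.
  by rewrite ler_norml; apply/andP; split; nra.
- by move=> j js; rewrite zE js (leq_trans js (ltnW sN)).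
- move=> j /andP[sj jN]; rewrite zE jN ltnNge (ltnW sj) /=.
  by rewrite ifN// -val_eqE /= gtn_eqF.
Qed.

(** * Comparison of consecutive grids *)

(** The coordinates start at [rho] and not at 0, so that a grid of large scale lies far from [p]. *)
Definition grid_coord {R : realType} {M : nat} (rho : R) (a : 'I_M) : R :=
  rho * (1 + a%:R / M%:R).

Lemma grid_coord_bound {R : realType} {M : nat} (rho : R) (a : 'I_M) :
  0 <= rho -> rho <= grid_coord rho a <= 2 * rho.
Proof.
move=> rho0; have M0 : (0 < M)%N := leq_ltn_trans (leq0n a) (ltn_ord a).
have a0 : 0 <= a%:R / M%:R :> R by rewrite divr_ge0.
have a1 : a%:R / M%:R <= 1 :> R.
  by rewrite ler_pdivrMr ?ltr0n// mul1r ler_nat ltnW.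
by rewrite /grid_coord; apply/andP; split; nra.
Qed.

(** The spacing is [rho / M <= r], and the resulting fraction [3 r / rho] of the indices does not
    depend on [M]. *)
Lemma card_grid_near {R : realType} (M : nat) (rho r s c : R) :
  0 < rho -> (0 < M)%N -> rho <= r * M%:R ->
  #|[pred a : 'I_M | `|c - (s + grid_coord rho a)| < r]|%:R
    <= 3 * r / rho * M%:R.
Proof.
move=> rho0 M0 rM; have M0' : 0 < M%:R :> R by rewrite ltr0n.
have -> : 3 * r / rho * M%:R = 3 * r / (rho / M%:R).
  by field; rewrite !gt_eqF.
have := @card_ord_near R M (s + rho - c) (rho / M%:R) r.
rewrite divr_gt0// ler_pdivrMr// => /(_ isT rM).
apply: le_trans; rewrite ler_nat; apply/subset_leq_card/fintype.subsetP => a.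
rewrite !inE distrC /grid_coord; congr (`|_| < _).
by field; rewrite gt_eqF.
Qed.

(** Indices are functions on all [n] coordinates although only the first [N] move the point: the
    others multiply every count by the same power of [M] and leave proportions unchanged. *)
Definition grid_in {R : realType} {n : nat} (Omega : set 'rV[R]_n)
    (p : 'rV[R]_n) (N M : nat) (e : R) : pred {ffun 'I_n -> 'I_M} :=
  fun a => `[< Omega (slice_point p N (fun l => grid_coord e (a l))) >].

(* Few pairs of points of two consecutive grids are joined by a coordinatewise
   path hitting a covering ball, so Omega cannot hold half of the first grid
   and less than half of the second. *)
Lemma grid_half_step {R : realType} {n : nat} (Omega : set 'rV[R]_n)
    (p : 'rV[R]_n) (k M n0 : nat) (x : nat -> 'rV[R]_n) (r : nat -> R)
    (rho : R) :
  open Omega -> (k < n)%N -> (0 < M)%N -> 0 < rho ->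
  (forall z, tboundary Omega z -> exists i : 'I_n0, edist (x i) z < r i) ->
  (forall i : 'I_n0, 0 < r i) ->
  (forall i : 'I_n0, 2 * rho <= r i * M%:R) ->
  (forall i : 'I_n0, r i <= edist p (x i) / 2) ->
  k.+1%:R * \sum_(i < n0 | edist p (x i) < 8 * k.+1%:R * rho)
    (3 * r i / rho) ^+ k <= 4^-1 ->
  (M ^ n <= 2 * #|grid_in Omega p k.+1 M rho|)%N ->
  (M ^ n <= 2 * #|grid_in Omega p k.+1 M (2 * rho)|)%N.
Proof.
move=> oO kn M0 rho0 cov r0 rM rd small.
set A := grid_in _ _ _ _ rho; set A2 := grid_in _ _ _ _ _ => hA.
rewrite leqNgt; apply/negP => hB.
pose B := predC A2.
have cB : (#|A2| + #|B| = M ^ n)%N.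
  by rewrite cardC card_ffun !card_ord.
pose d i := edist p (x i).
(* If the path from [a] to [b] hits ball [i] on leg [l], then the coordinates of [a] after [l] and
   those of [b] before [l] are close to those of [x i]. *)
pose Fx (i : 'I_n0) (l : 'I_n) (j : 'I_n) : pred 'I_M :=
  [pred a | (l < j < k.+1)%N ==>
    (`|x i ord0 j - (p ord0 j + grid_coord rho a)| < r i)].
pose Fy (i : 'I_n0) (l : 'I_n) (j : 'I_n) : pred 'I_M :=
  [pred a | (j < l)%N ==>
    (`|x i ord0 j - (p ord0 j + grid_coord (2 * rho) a)| < r i)].
(* A crossing point is within [4 (k+1) rho] of [p] and within [r i <= d i / 2] of [x i], whence
   [d i < 8 (k+1) rho]. *)
pose Q (il : 'I_n0 * 'I_n) := (d il.1 < 8 * k.+1%:R * rho) && (il.2 < k.+1)%N.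
have AB : (#|A| * #|B| <= \sum_(il | Q il)
    #|predX (family (Fx il.1 il.2)) (family (Fy il.1 il.2))|)%N.
  rewrite -cardX; apply: card_le_sum_cover => -[a b] /andP[/= /asboolP Oa].
  rewrite /B /= => /asboolPn Ob.
  have [] := @coordinate_path_meets_boundary R n Omega p k.+1 _ _ (4 * rho)
    oO kn _ _ _ Oa Ob.
  - by rewrite mulr_ge0 ?ltW.
  - move=> l; have /andP[g1 g2] := grid_coord_bound rho (a l) (ltW rho0).
    by apply/andP; split; lra.
  - move=> l; have := grid_coord_bound (2 * rho) (b l).
    rewrite mulr_ge0 ?(ltW rho0)// => /(_ isT) /andP[g1 g2].
    by apply/andP; split; lra.
  move=> l [z [lN /cov [i iz] pz zg zf]].
  have xz j : `|x i ord0 j - z ord0 j| < r i.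
    exact: le_lt_trans (edist_coord _ _ _) iz.
  exists (i, l); rewrite /Q /= ?lN ?andbT.
    have := edist_triangle z p (x i); rewrite -/(d i) (edistC z) => tr.
    have := rd i; rewrite -/(d i) => rdi; lra.
  apply/andP; split; apply/forallP => j; rewrite !inE; apply/implyP => jl.
    by rewrite -zf.
  by rewrite -zg.
have card_il il : Q il ->
    #|predX (family (Fx il.1 il.2)) (family (Fy il.1 il.2))|%:R
    <= (3 * r il.1 / rho) ^+ k * (M%:R ^+ n) ^+ 2.
  case: il => i l /andP[/= _ lk]; apply: (@card_pair_family_le R n k.+1 M l) => //.
  - by rewrite divr_ge0 ?mulr_ge0 ?(ltW rho0)// ltW.
  - move=> j jl.
    apply: (le_trans _ (card_grid_near M rho (r i) (p ord0 j) (x i ord0 j) rho0 M0 _)).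
      by rewrite ler_nat; apply/subset_leq_card/fintype.subsetP => a; rewrite !inE jl.
    by have := rM i; lra.
  - move=> j jl; have rho2 : 0 < 2 * rho by rewrite mulr_gt0.
    apply: (@le_trans _ _ (3 * r i / (2 * rho) * M%:R)).
      apply: (le_trans _ (card_grid_near M (2 * rho) (r i) (p ord0 j) (x i ord0 j) rho2 M0 (rM i))).
      by rewrite ler_nat; apply/subset_leq_card/fintype.subsetP => a; rewrite !inE jl.
    rewrite ler_wpM2r// ler_pM2l ?mulr_gt0// lef_pV2 ?posrE//; lra.
have T0 : (0 < M ^ n)%N by rewrite expn_gt0 M0.
(* [A] holds at least half of the indices and [B] more than half, so more than a quarter of all
   pairs must be joined by a path hitting a ball; the smallness hypothesis allows at most a
   quarter. *)
have : (M ^ n * M ^ n < 4 * (#|A| * #|B|))%N.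
  have A0 : (0 < #|A|)%N by lia.
  by nia.
rewrite ltnNge => /negP; apply.
rewrite -(ler_nat R) !natrM natrX -expr2.
apply: (@le_trans _ _ (4 * \sum_(il | Q il)
    ((3 * r il.1 / rho) ^+ k * (M%:R ^+ n) ^+ 2))).
  rewrite ler_pM2l// -natrM (le_trans (_ : _ <= (\sum_(il | Q il)
    #|predX (family (Fx il.1 il.2)) (family (Fy il.1 il.2))|)%:R))//.
    by rewrite ler_nat.
  by rewrite natr_sum; apply: ler_sum.
rewrite -mulr_suml mulrA ler_piMl ?sqr_ge0//.
have -> : \sum_(il | Q il) (3 * r il.1 / rho) ^+ k =
    k.+1%:R * \sum_(i < n0 | d i < 8 * k.+1%:R * rho) (3 * r i / rho) ^+ k.
  rewrite -(pair_big (fun i : 'I_n0 => d i < 8 * k.+1%:R * rho)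
    (fun l : 'I_n => (l < k.+1)%N) (fun i _ => (3 * r i / rho) ^+ k)) /=.
  rewrite mulr_sumr; apply: eq_bigr => i _.
  by rewrite (big_ord_narrow kn) sumr_const card_ord -[LHS]mulr_natl.
by rewrite -ler_pdivlMl// mulr1.
Qed.

(** * Density of the boundary balls around a point of the domain *)

(** The factor 4 comes from the quarter in [grid_half_step], [k+1] from the number of legs, and
    [24 (k+1)] from the 3 of the grid count times the ratio [8 (k+1)] of the radius to [rho]. *)
Definition density_const {R : realType} (k : nat) : R :=
  (4 * k.+1%:R * (24 * k.+1%:R) ^+ k)^-1.

Lemma density_const_gt0 {R : realType} (k : nat) : 0 < density_const k :> R.
Proof. by rewrite invr_gt0 !mulr_gt0// exprn_gt0 ?mulr_gt0. Qed.

(** This makes a single ball of radius [r] dense enough at radius [2 r]. *)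
Lemma density_const_pow2 {R : realType} (k : nat) (m : R) :
  m <= k%:R -> density_const k * 2 `^ m <= 1.
Proof.
move=> mk; have D0 : 0 < (4 * k.+1%:R * (24 * k.+1%:R) ^+ k) :> R.
  by rewrite -invr_gt0 density_const_gt0.
rewrite /density_const mulrC ler_pdivrMr// mul1r.
apply: (@le_trans _ _ (2 ^+ k)).
  by rewrite -powR_mulrn// ler_powR// ler1n.
have k1 : 1 <= k.+1%:R :> R by rewrite ler1n.
apply: (@le_trans _ _ ((24 * k.+1%:R) ^+ k)).
  by apply: lerXn2r; rewrite ?nnegrE; lra.
by rewrite ler_peMl ?exprn_ge0//; lra.
Qed.

Lemma exists_grid_size {R : realType} (n0 : nat) (r : nat -> R) (e : R) :
  (forall i : 'I_n0, 0 < r i) ->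
  exists2 M : nat, (0 < M)%N & forall i : 'I_n0, e <= r i * M%:R.
Proof.
move=> r0; pose u (i : 'I_n0) := (Num.truncn `|e / r i|).+1.
exists (\sum_i u i).+1 => // i.
rewrite mulrC -ler_pdivrMr// (le_trans (ler_norm _))//.
rewrite (le_trans (ltW (truncnS_gt _)))// ler_nat leqW// (bigD1 i)//=.
exact: leq_addr.
Qed.

Lemma boundary_density {R : realType} {n : nat} (Omega : set 'rV[R]_n)
    (p : 'rV[R]_n) (k n0 : nat) (x : nat -> 'rV[R]_n) (r : nat -> R) (m : R) :
  open Omega -> ebounded Omega -> (k < n)%N -> 0 < m -> m <= k%:R ->
  (forall z, tboundary Omega z -> exists i : 'I_n0, edist (x i) z < r i) ->
  (forall i : 'I_n0, 0 < r i) -> Omega p ->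
  exists2 rho : R, 0 < rho & density_const k * rho `^ m <=
    \sum_(i < n0 | edist p (x i) < rho) r i `^ m.
Proof.
move=> oO [c [Mb OMb]] kn m0 mk cov r0 Op; apply: contrapT => noRho.
have neg rho : 0 < rho -> \sum_(i < n0 | edist p (x i) < rho) r i `^ m <
    density_const k * rho `^ m.
  by move=> rho0; rewrite ltNge; apply/negP => H; apply: noRho; exists rho.
(* Otherwise ball [i] alone would make [2 * r i] a good radius. *)
have rd (i : 'I_n0) : r i <= edist p (x i) / 2.
  rewrite leNgt; apply/negP => dr; have r2 : 0 < 2 * r i by rewrite mulr_gt0.
  have := neg _ r2; rewrite ltNge => /negP; apply.
  rewrite (bigD1 i) /=; last by lra.
  rewrite powRM ?(ltW (r0 i))// mulrA; apply: (@le_trans _ _ (r i `^ m)).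
    by rewrite ler_piMl ?powR_ge0// density_const_pow2.
  by rewrite lerDl; apply: sumr_ge0 => j _; exact: powR_ge0.
have small rho : 0 < rho ->
    k.+1%:R * \sum_(i < n0 | edist p (x i) < 8 * k.+1%:R * rho)
      (3 * r i / rho) ^+ k <= 4^-1.
  move=> rho0; set D := 8 * k.+1%:R * rho.
  have D0 : 0 < D by rewrite !mulr_gt0.
  have Dm0 : 0 < D `^ m by rewrite powR_gt0.
  apply: (@le_trans _ _ (k.+1%:R * \sum_(i < n0 | edist p (x i) < D)
      ((24 * k.+1%:R) ^+ k * (r i `^ m / D `^ m)))).
    rewrite ler_pM2l//; apply: ler_sum => i di.
    have -> : 3 * r i / rho = 24 * k.+1%:R * (r i / D).
      rewrite /D; move: (k.+1%:R : R) (ltr0Sn R k) => N N0.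
      by field; rewrite !gt_eqF.
    rewrite exprMn ler_pM2l ?exprn_gt0 ?mulr_gt0//.
    have rD0 : 0 < r i / D by rewrite divr_gt0.
    rewrite -powR_mulrn ?(ltW rD0)//.
    (* As [r i / D <= 1] and [m <= k], lowering the exponent from [k] to [m] does not decrease the
       power. *)
    apply: (@le_trans _ _ ((r i / D) `^ m)).
      rewrite ger_powR// rD0 ler_pdivrMr// mul1r.
      by have := rd i; have := edist_ge0 p (x i); lra.
    by rewrite powRM ?invr_ge0 ?(ltW D0) ?(ltW (r0 i))//
      -[D^-1]powR_inv1 ?(ltW D0)// -powRrM mulN1r powRN.
  rewrite -mulr_sumr -mulr_suml mulrA.
  have := neg D D0; rewrite -ltr_pdivrMr// => /ltW H.
  have K0 : 0 < k.+1%:R * (24 * k.+1%:R) ^+ k :> R.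
    by rewrite mulr_gt0// exprn_gt0 ?mulr_gt0.
  rewrite mulrC -ler_pdivlMr// (le_trans H)// /density_const.
  by rewrite -mulrA invfM.
have [e /= e0 ballO] : exists2 e : R, 0 < e & ball p e `<=` Omega.
  by apply/nbhs_ballP; exact: oO.
(* [ball] is a coordinatewise ball, and the first grid moves each coordinate of [p] by at most
   [2 rho0 < e]. *)
pose rho0 := e / 4; have rho00 : 0 < rho0 by rewrite divr_gt0.
(* Points of [Omega] are less than [2 Mb] apart, so the grid of scale [2 ^+ J * rho0] misses
   [Omega]. *)
pose J := (Num.truncn `|2 * Mb / rho0|).+1.
have farJ : 2 * Mb < 2 ^+ J * rho0.
  rewrite -ltr_pdivrMr// (le_lt_trans (ler_norm _))// (lt_le_trans (truncnS_gt _))//.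
  by rewrite -natrX ler_nat ltnW// ltn_expl.
(* One [M], fine enough for the largest scale, serves all the grids. *)
have [M M0 rM] := @exists_grid_size R n0 r (2 ^+ J * rho0) r0.
have half j : (j <= J)%N ->
    (M ^ n <= 2 * #|grid_in Omega p k.+1 M (2 ^+ j * rho0)|)%N.
  elim: j => [_|j IH jJ].
    rewrite expr0 mul1r (eq_card (B := predT)) => [|a].
      by rewrite card_ffun !card_ord leq_pmull.
    rewrite unfold_in; apply/asboolP/ballO; split => // i l.
    rewrite (ord1 i) /ball /= !mxE.
    have /andP[g1 g2] := grid_coord_bound rho0 (a l) (ltW rho00).
    case: ifPn => _; rewrite opprD addrA subrr sub0r normrN ?normr0//.
    by rewrite ger0_norm; rewrite /rho0 in g1 g2 *; lra.
  rewrite exprS -mulrA.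
  apply: (@grid_half_step R n Omega p k M n0 x r) => //.
  - by rewrite mulr_gt0// exprn_gt0.
  - move=> i; apply: le_trans (rM i).
    by rewrite mulrA -exprS ler_pM2r// ler_eXn2l ?ltr1n.
  - by apply: small; rewrite mulr_gt0// exprn_gt0.
  - exact/IH/ltnW.
have := half J (leqnn J); rewrite eq_card0 => [|a].
  by rewrite muln0 leqn0 expn_eq0 gtn_eqF.
apply/negP => /asboolP /OMb; have := OMb _ Op; rewrite /eball /=.
set z := slice_point _ _ _ => cp cz.
have := edist_triangle c p z; rewrite (edistC p c) => pz.
have := edist_coord p z (Ordinal kn); rewrite !mxE /= ltnSn.
have P0 : 0 <= 2 ^+ J * rho0 by rewrite mulr_ge0 ?exprn_ge0// ltW.
have /andP[g1 _] := grid_coord_bound (2 ^+ J * rho0) (a (Ordinal kn)) P0.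
rewrite opprD addrA subrr sub0r normrN ger0_norm; last exact: le_trans g1.
lra.
Qed.

(** * Passage to finite covers of the domain *)

(* Choosing a point of almost maximal radius and discarding the points whose
   balls share an indexed center with its ball keeps the sums disjoint. *)
Lemma greedy_cover {R : realType} {n : nat} (n0 : nat) (x : nat -> 'rV[R]_n)
    (w : nat -> R) (m eps K : R) (rho : 'rV[R]_n -> R) (T : pred 'I_n0)
    (A : set 'rV[R]_n) :
  0 < eps -> (forall i, 0 <= w i) ->
  (forall p, A p -> 0 < rho p <= K) ->
  (forall p, A p -> forall i : 'I_n0, edist p (x i) < rho p -> T i) ->
  (forall p, A p ->
    eps * rho p `^ m <= \sum_(i < n0 | edist p (x i) < rho p) w i) ->
  exists L : seq 'rV[R]_n,
    [/\ forall q, A q -> exists2 p, p \in L & edist p q < 3 * rho p,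
      forall p, p \in L -> 0 < rho p &
      eps * \sum_(p <- L) rho p `^ m <= \sum_(i < n0 | T i) w i].
Proof.
(* Induction on the number of indices still available; each selected point uses up at least one. *)
move=> eps0 w0; move: {2}#|T|.+1 (ltnSn #|T|) => s.
elim: s T A => // s IH T A; rewrite ltnS => Ts rhoK AT Aw.
have [[p0 Ap0]|A0] := pselect (A !=set0); last first.
  exists [::]; split => // [q Aq|]; first by case: A0; exists q.
  by rewrite big_nil mulr0 sumr_ge0.
have supA : has_sup (rho @` A).
  split; first by exists (rho p0), p0.
  by exists K => _ [q Aq <-]; case/andP: (rhoK q Aq).
have sup0 : 0 < sup (rho @` A).
  case/andP: (rhoK _ Ap0) => rho0 _; apply: (lt_le_trans rho0).
  by apply: ub_le_sup; [exact: supA.2|exists p0].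
have [|_ [p Ap <-] psup] := @sup_adherent _ _ (sup (rho @` A) / 2) _ supA.
  by rewrite divr_gt0.
have qp q : A q -> rho q < 2 * rho p.
  move=> Aq; have : rho q <= sup (rho @` A).
    by apply: ub_le_sup; [exact: supA.2|exists q].
  by lra.
case/andP: (rhoK _ Ap) => rhop0 _.
pose Ip (i : 'I_n0) := edist p (x i) < rho p.
have [i0 Ii0] : exists i, Ip i.
  apply: contrapT => noI; have := Aw p Ap; rewrite big_pred0 => [|i].
    by apply/negP; rewrite -ltNge mulr_gt0// powR_gt0.
  by apply/negP => Ii; apply: noI; exists i.
pose T' := [pred i | T i && ~~ Ip i].
pose A' := [set q | A q /\ forall i : 'I_n0, edist q (x i) < rho q -> ~~ Ip i].
have [||q [Aq qI]|q [Aq qI]|L [Lcov Lrho Lw]] := IH T' A'.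
- apply: leq_trans Ts; apply: proper_card; apply/properP; split.
    by apply/fintype.subsetP => i /andP[].
  exists i0; first exact: AT Ii0.
  by rewrite !inE Ii0 andbF.
- by move=> q [Aq _]; exact: rhoK.
- by move=> i qi; rewrite /= (AT q Aq)//= qI.
- exact: Aw.
exists (p :: L); split.
- move=> q Aq; have [A'q|nA'q] := pselect (A' q).
    by have [p' p'L p'q] := Lcov q A'q; exists p' => //; rewrite inE p'L orbT.
  exists p; first by rewrite mem_head.
  (* A discarded [q] shares a center with [p], so [edist p q < rho p + rho q < 3 * rho p]. *)
  have [i qi Ii] : exists2 i : 'I_n0, edist q (x i) < rho q & Ip i.
    apply: contrapT => noI; apply: nA'q; split => // i qi.
    by apply/negP => Ii; apply: noI; exists i.
  have := edist_triangle (x i) p q; rewrite (edistC (x i)).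
  by have := qp q Aq; move: Ii; rewrite /Ip; lra.
- by move=> q; rewrite inE => /predU1P[->//|]; exact: Lrho.
- rewrite big_cons mulrDr (bigID Ip) /=; apply: lerD => //.
  apply: (le_trans (Aw p Ap)); rewrite le_eqVlt; apply/orP; left; apply/eqP.
  apply: eq_bigl => i; rewrite -/(Ip i); case Ii: (Ip i); rewrite ?andbF ?andbT//.
  by rewrite (AT p Ap).
Qed.

(* The finite cover is completed to a sequence by an arbitrary tail of balls. *)
Lemma HC_le_finite_cover {R : realType} {n : nat} (m : R) (A : set 'rV[R]_n)
    (L : seq 'rV[R]_n) (s : 'rV[R]_n -> R) (r : nat -> R) :
  (forall i, 0 < r i) -> (forall p, p \in L -> 0 < s p) ->
  (forall q, A q -> exists2 p, p \in L & edist p q < s p) ->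
  (HC m A <= (\sum_(p <- L) s p `^ m)%:E + \sum_(0 <= i <oo) (r i `^ m)%:E)%E.
Proof.
move=> r0 s0 cov.
pose t i := if (i < size L)%N then s (nth 0 L i) else r i.
have p0 (u : nat -> R) i : (0 <= (u i `^ m)%:E)%E by rewrite lee_fin powR_ge0.
apply: ge_ereal_inf; exists (\sum_(0 <= i <oo) (t i `^ m)%:E)%E.
  exists t => //; exists (nth 0 L); split.
    by move=> i; rewrite /t; case: ifPn => // iL; apply/s0/mem_nth.
  move=> q /cov [p pL pq]; exists (index p L) => //.
  by rewrite /eball /t /= index_mem pL nth_index.
rewrite (@nneseries_split _ _ 0 (size L)) ?add0n//; apply: leeD.
  rewrite sumEFin lee_fin [leRHS](big_nth 0).
  by apply: ler_sum_nat => i /andP[_ iL]; rewrite /t iL.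
rewrite [leRHS](@nneseries_split _ _ 0 (size L)) ?add0n// -[leLHS]add0e.
apply: leeD; first by apply: sume_ge0.
apply: lee_lim.
- by apply: is_cvg_nneseries => i _ _; exact: p0.
- by apply: is_cvg_nneseries => i _ _; exact: p0.
- apply: nearW => N; rewrite !sumEFin lee_fin.
  by apply: ler_sum_nat => i /andP[Li _]; rewrite /t ltnNge Li.
Qed.

(** * The constant and the final estimate *)

(** The factor [3 ^ m] pays for tripling the selected radii, and the summand 1 for the tail that
    completes the finite cover to a sequence. *)
Definition boxing_const {R : realType} (m : R) : R :=
  3 `^ m / density_const `|Num.ceil m|%N + 1.

Lemma boxing_const_gt0 {R : realType} (m : R) : 0 < boxing_const m.
Proof.
by rewrite ltr_pwDr// divr_ge0 ?powR_ge0// ltW// density_const_gt0.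
Qed.

Lemma HC_le_boundary_cover {R : realType} {n : nat} (Omega : set 'rV[R]_n.+1)
    (m : R) (x : nat -> 'rV[R]_n.+1) (r : nat -> R) :
  open Omega -> ebounded Omega -> 0 < m -> m <= n%:R ->
  (forall i, 0 < r i) -> tboundary Omega `<=` \bigcup_i eball (x i) (r i) ->
  (HC m Omega <= (boxing_const m)%:E * \sum_(0 <= i <oo) (r i `^ m)%:E)%E.
Proof.
move=> oO bO m0 mn r0 cov.
pose k := `|Num.ceil m|%N.
have kE : (k%:Z = Num.ceil m)%R by rewrite /k gez0_abs// ceil_ge0; lra.
have mk : m <= k%:R by rewrite -[k%:R]/(k%:Z%:~R) kE ceil_ge.
(* As [n] is an integer, [m <= n] passes to the ceiling, and a slice of dimension [k+1] fits. *)
have kn : (k < n.+1)%N by rewrite ltnS -lez_nat kE ceil_le_int.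
have [n0 fcov] := finite_subcover_tboundary _ _ _ bO cov.
set eps := density_const k : R; have eps0 : 0 < eps by exact: density_const_gt0.
have /choice [rho rhoP] (p : 'rV[R]_n.+1) : exists rho : R, Omega p ->
    0 < rho /\ eps * rho `^ m <= \sum_(i < n0 | edist p (x i) < rho) r i `^ m.
  have [Op|nOp] := pselect (Omega p); last by exists 0.
  have [|rho rho0 rhoD] := @boundary_density R _ Omega p k n0 x r m
    oO bO kn m0 mk fcov _ Op; first by move=> i.
  by exists rho.
pose S := \sum_(i < n0) r i `^ m.
(* The total sum bounds all radii, which makes their supremum finite in the greedy selection. *)
have rhoK p : Omega p -> 0 < rho p <= (S / eps) `^ m^-1.
  move=> /rhoP [rho0 rhoS]; rewrite rho0 /=.
  have -> : rho p = (rho p `^ m) `^ m^-1.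
    by rewrite -powRrM mulfV ?gt_eqF// powRr1// ltW.
  rewrite ge0_ler_powR ?nnegrE ?invr_ge0 ?powR_ge0 ?(ltW m0)//.
    by rewrite divr_ge0 ?(ltW eps0)// sumr_ge0// => i _; exact: powR_ge0.
  rewrite ler_pdivlMr// mulrC (le_trans rhoS)// /S big_mkcond.
  by apply: ler_sum => i _; case: ifP; rewrite ?powR_ge0.
have [L [Lcov Lrho LS]] := @greedy_cover R _ n0 x (fun i => r i `^ m) m eps _ rho
  predT Omega eps0 (fun i => powR_ge0 _ _) rhoK (fun _ _ _ _ => isT)
  (fun p Op => (rhoP p Op).2).
have L3 p : p \in L -> 0 < 3 * rho p by move=> /Lrho ?; rewrite mulr_gt0.
apply: (le_trans (HC_le_finite_cover m Omega L (fun p => 3 * rho p) r r0 L3 Lcov)).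
have p0 i : (0 <= (r i `^ m)%:E)%E by rewrite lee_fin powR_ge0.
have c0 : 0 <= 3 `^ m / eps by rewrite divr_ge0 ?powR_ge0// ltW.
rewrite /boxing_const -/k -/eps EFinD ge0_muleDl ?lee_fin// mul1e.
apply: leeD => //; apply: (@le_trans _ _ ((3 `^ m / eps)%:E * S%:E)%E).
  rewrite -EFinM lee_fin mulrAC ler_pdivlMr// mulrC.
  rewrite (eq_big_seq (fun p => 3 `^ m * rho p `^ m)) => [|p /Lrho rp]; last first.
    by rewrite powRM// ltW.
  by rewrite -mulr_sumr mulrCA ler_wpM2l ?powR_ge0.
apply: lee_wpmul2l; first by rewrite lee_fin.
rewrite /S -(big_mkord xpredT (fun i => r i `^ m)) -sumEFin.
by apply: nneseries_lim_ge => i _ _; exact: p0.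
Qed.

Theorem theorem1p2 (R : realType) :
  exists c : R -> R,
    (forall m : R, 0 < m -> 0 < c m) /\
    forall (n : nat) (Omega : set 'rV[R]_(n.+1)),
      (1 <= n)%N ->
      open Omega -> connected Omega -> Omega !=set0 -> ebounded Omega ->
      forall m : R, 0 < m -> m <= n%:R ->
        (HC m Omega <= (c m)%:E * HC m (tboundary Omega))%E.
Proof.
exists boxing_const; split => [m _|n Omega _ oO _ _ bO m m0 mn].
  exact: boxing_const_gt0.
(* Dividing by the constant reduces the claim to a lower bound for the sum of each boundary
   cover. *)
rewrite -lee_pdivrMl ?boxing_const_gt0//; apply: le_ereal_inf_tmp.
move=> _ [r [x [r0 cov]] <-].
by rewrite lee_pdivrMl ?boxing_const_gt0//; exact: (HC_le_boundary_cover _ _ x).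
Qed.
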